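(* Let $\Omega\subseteq\mathbb{R}^n$ be a smooth domain and let $f:[0,\infty)\to[0,\infty)$ be continuous and nondecreasing. Let $\phi\in L^1_+(\Omega)$ and suppose that there exist constants $A>1$, $T>0$ and functions $\psi\in L^1_+(\Omega)$, $g:[0,\infty)\to[0,\infty)$ and $h:[0,T]\to[0,\infty)$ such that $$S(t)\phi\le g\left(S(t)\psi\right)\quad\text{and}\quad 1+\left\|\frac{S(t)\psi}{g(S(t)\psi)}\right\|_{L^\infty(\Omega)}\int_0^t h(s)\,\mathrm{d}s\le A$$ for $t\in[0,T]$, where $$h(t)=\left\|\frac{f\left(A\,g\left(S(t)\psi\right)\right)}{S(t)\psi}\right\|_{L^\infty(\Omega)}.$$ Then $w(t)=S(t)\phi+S(t)\psi\int_0^t h(s)\,\mathrm{d}s$ is a supersolution for $t\in[0,T]$.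
   Context: $L^1_+(\Omega)$ is the set of a.e. nonnegative integrable functions on $\Omega$. $\{S(t)\}_{t\ge 0}$ is the Dirichlet heat semigroup on $\Omega$, $(S(t)\phi)(x)=\int_\Omega K(t,x,y)\phi(y)\,\mathrm{d}y$, where $K\ge 0$ is the (Dirichlet) heat kernel of $\Omega$. Let $\mathscr{F}[v](t)=S(t)\phi+\int_0^t S(t-s)f(v(s))\,\mathrm{d}s$. $\mathcal{M}_T^+$ denotes the set of nonnegative, almost everywhere finite, measurable functions on $\Omega_T=\Omega\times(0,T)$. A supersolution (for $t\in[0,T]$, i.e. on $\Omega_T$) is any $w\in\mathcal{M}_T^+$ with $\mathscr{F}[w]\le w$ a.e. in $\Omega_T$. *)

(* Defs.v *)
From HB Require Import structures.
From mathcomp Require Import all_boot all_order all_algebra.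
From mathcomp Require Import all_classical all_reals all_analysis.
From mathcomp Require Import measurable_realfun.

Set Implicit Arguments.
Unset Strict Implicit.
Unset Printing Implicit Defensive.

Import Order.TTheory GRing.Theory Num.Theory.
Import numFieldNormedType.Exports.

Local Open Scope classical_set_scope.
Local Open Scope ring_scope.

(* The sigma-algebra on R^n is the one generated by the coordinates, i.e. the
   Borel sigma-algebra. *)
Section measurable_rV.
Context {R : realType} (n : nat).

Let coord (i : 'I_n) (x : 'rV[R]_n) : R := x ord0 i.

Let rV_set0 : g_sigma_preimage coord set0.
Proof. exact: sigma_algebra0. Qed.

Let rV_setC A : g_sigma_preimage coord A -> g_sigma_preimage coord (~` A).
Proof. exact: sigma_algebraC. Qed.

Let rV_bigcup (F : (set 'rV[R]_n)^nat) :
  (forall i, g_sigma_preimage coord (F i)) ->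
  g_sigma_preimage coord (\bigcup_i (F i)).
Proof. exact: sigma_algebra_bigcup. Qed.

HB.instance Definition _ := @isMeasurable.Build default_measure_display
  'rV[R]_n (g_sigma_preimage coord) rV_set0 rV_setC rV_bigcup.

End measurable_rV.

Lemma measurable_rVP {R : realType} d (T : measurableType d) n
    (f : T -> 'rV[R]_n) :
  (forall i, measurable_fun setT (fun t => f t ord0 i)) ->
  measurable_fun setT f.
Proof.
move=> mf.
have sub : g_sigma_preimage (fun (i : 'I_n) t => f t ord0 i) `<=` measurable.
  apply: smallest_sub; first exact: sigma_algebra_measurable.
  elim/big_ind : _ => //.
  - by move=> A B sA sB C [/sA|/sB].
  - by move=> i _ A [B mB <-]; exact: mf.
move=> _ A mA.
apply: sub.
rewrite (_ : (fun _ _ => _) = (fun i => (fun x : 'rV[R]_n => x ord0 i) \o f))//.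
by rewrite g_sigma_preimage_comp; exists A.
Qed.

Lemma measurable_coord {R : realType} n (i : 'I_n) :
  measurable_fun setT (fun x : 'rV[R]_n => x ord0 i).
Proof.
move=> _ Y mY; rewrite setTI; apply: sub_sigma_algebra => /=.
rewrite -bigcup_seq/=; exists i => /=; first by rewrite mem_index_enum.
by exists Y => //; rewrite setTI.
Qed.

Definition consrV {R : realType} n (p : R * 'rV[R]_n) : 'rV[R]_n.+1 :=
  \row_i if unlift ord0 i is Some j then p.2 ord0 j else p.1.

Lemma measurable_consrV {R : realType} n :
  measurable_fun setT (@consrV R n).
Proof.
apply: measurable_rVP => i.
rewrite (_ : (fun _ => _) = fun p : R * 'rV[R]_n =>
  if unlift ord0 i is Some j then p.2 ord0 j else p.1); last first.
  by apply/funext => p; rewrite mxE.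
case: unliftP => [j _|_]; last exact: measurable_fst.
by apply: (measurableT_comp (measurable_coord j)); exact: measurable_snd.
Qed.

Lemma product_sigma_finite d1 d2 (T1 : measurableType d1)
    (T2 : measurableType d2) (R : realType)
    (m1 : {sigma_finite_measure set T1 -> \bar R})
    (m2 : {sigma_finite_measure set T2 -> \bar R}) :
  sigma_finite setT (m1 \x m2)%E.
Proof.
have /sigma_finiteP[F [TF ndF Foo]] := sigma_finiteT m1.
have /sigma_finiteP[G [TG ndG Goo]] := sigma_finiteT m2.
exists (fun n => F n `*` G n).
  rewrite -setXTT TF TG predeqE => -[x y]; split.
    move=> [/= [n _ Fnx] [k _ Gky]]; exists (maxn n k) => //; split.
    - by move: x Fnx; exact/subsetPset/ndF/leq_maxl.
    - by move: y Gky; exact/subsetPset/ndG/leq_maxr.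
  by move=> [n _ []/= ? ?]; split; exists n.
move=> k; have [? ?] := Foo k; have [? ?] := Goo k.
split; first exact: measurableX.
by rewrite product_measure1E// lte_mul_pinfty// ge0_fin_numE.
Qed.

Section lebesgue_cons.
Context {R : realType} (n : nat).
Variable mu : {sigma_finite_measure set 'rV[R]_n -> \bar R}.

(* The image of (Lebesgue measure on R) x mu under R x R^n ~ R^(n+1). *)
Definition lebesgue_cons : set 'rV[R]_n.+1 -> \bar R :=
  pushforward (@lebesgue_measure R \x mu)%E (@consrV R n).

Let lebesgue_cons0 : lebesgue_cons set0 = 0%E.
Proof. by rewrite /lebesgue_cons /pushforward preimage_set0 measure0. Qed.

Let lebesgue_cons_ge0 A : (0 <= lebesgue_cons A)%E.
Proof. by rewrite /lebesgue_cons /pushforward; exact: measure_ge0. Qed.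

Let lebesgue_cons_sigma_additive : semi_sigma_additive lebesgue_cons.
Proof.
move=> F mF tF mUF; rewrite /lebesgue_cons /pushforward preimage_bigcup.
have mc := @measurable_consrV R n.
apply: measure_semi_sigma_additive.
- by move=> k; rewrite -[X in measurable X]setTI; exact: mc.
- apply/trivIsetP => /= i j _ _ ij; rewrite -preimage_setI.
  by move/trivIsetP : tF => /(_ _ _ _ _ ij) ->//; rewrite preimage_set0.
- by rewrite -preimage_bigcup -[X in measurable X]setTI; exact: mc.
Qed.

HB.instance Definition _ := isMeasure.Build _ _ _ lebesgue_cons
  lebesgue_cons0 lebesgue_cons_ge0 lebesgue_cons_sigma_additive.

Let lebesgue_cons_sigma_finite : sigma_finite setT lebesgue_cons.
Proof.
have [F FT mF] := product_sigma_finite (@lebesgue_measure R) mu.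
pose tl (x : 'rV[R]_n.+1) : R * 'rV[R]_n :=
  (x ord0 ord0, \row_j x ord0 (lift ord0 j)).
have mtl : measurable_fun setT tl.
  apply: measurable_fun_pair; first exact: measurable_coord.
  apply: measurable_rVP => i.
  rewrite (_ : (fun _ => _) = fun x : 'rV[R]_n.+1 => x ord0 (lift ord0 i)).
    exact: measurable_coord.
  by apply/funext => x; rewrite mxE.
have consK : cancel (@consrV R n) tl.
  case=> a v; rewrite /tl /consrV mxE unlift_none /=; congr pair.
  by apply/rowP => j; rewrite !mxE liftK.
exists (fun k => tl @^-1` F k).
  by rewrite -preimage_bigcup -FT preimage_setT.
move=> k; split; first by rewrite -[X in measurable X]setTI; apply: mtl (mF k).1.
rewrite /lebesgue_cons /pushforward -comp_preimage.
rewrite (_ : _ @^-1` F k = F k); first exact: (mF k).2.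
by apply/seteqP; split => p /=; rewrite consK.
Qed.

HB.instance Definition _ := Measure_isSigmaFinite.Build _ _ _ lebesgue_cons
  lebesgue_cons_sigma_finite.

End lebesgue_cons.

(* n-dimensional Lebesgue measure. *)
Fixpoint lebesgue_rV (R : realType) (n : nat) :
    {sigma_finite_measure set 'rV[R]_n -> \bar R} :=
  match n with
  | 0 => @dirac _ 'rV[R]_0 0 R
  | m.+1 => lebesgue_cons (lebesgue_rV R m)
  end.

Lemma measurable_box {R : realType} n (B : 'I_n -> set R) :
  (forall i, measurable (B i)) ->
  measurable [set x : 'rV[R]_n | forall i, B i (x ord0 i)].
Proof.
move=> mB; rewrite (_ : [set _ | _] =
    \bigcap_(i in setT) ((fun x : 'rV[R]_n => x ord0 i) @^-1` B i)).
  apply: fin_bigcap_measurable => // i _.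
  by rewrite -[X in measurable X]setTI; exact: measurable_coord.
by apply/seteqP; split => x /= h i; [move=> _|]; apply: h.
Qed.

Lemma lebesgue_rV_box (R : realType) n (B : 'I_n -> set R) :
  (forall i, measurable (B i)) ->
  lebesgue_rV R n [set x : 'rV[R]_n | forall i, B i (x ord0 i)] =
  (\prod_(i < n) @lebesgue_measure R (B i))%E.
Proof.
elim: n B => [|n IH] B mB.
  rewrite big_ord0 /= diracE mem_set//= => -[].
  by [].
rewrite big_ord_recl /= /lebesgue_cons /pushforward.
rewrite (_ : _ @^-1` _ = B ord0 `*`
    [set x : 'rV[R]_n | forall i, B (lift ord0 i) (x ord0 i)]).
  rewrite product_measure1E; [|exact: mB|].
    by rewrite (IH (fun i => B (lift ord0 i))).
  exact: (measurable_box (B := fun i => B (lift ord0 i))).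
apply/seteqP; split => -[a v] /=.
  move=> h; split; first by have := h ord0; rewrite mxE unlift_none.
  by move=> i; have := h (lift ord0 i); rewrite mxE liftK.
move=> [Ba Bv] i; rewrite mxE; case: unliftP => [j ->|->] //; exact: Bv.
Qed.

Section differential_calculus.
Context {R : realType} {n : nat}.
Implicit Types (U : set 'rV[R]_n) (u : 'rV[R]_n -> R).

Definition partial (i : 'I_n) u : 'rV[R]_n -> R := 'D_(delta_mx 0 i) u.

Definition laplacian u (x : 'rV[R]_n) : R :=
  \sum_(i < n) partial i (partial i u) x.

(* u is of class C^k on U; meant for U open. *)
Fixpoint class_C (k : nat) U u : Prop :=
  (forall x, U x -> {for x, continuous u}) /\
  match k with
  | 0 => True
  | m.+1 => forall i : 'I_n, (forall x, U x -> derivable u x (delta_mx 0 i)) /\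
              class_C m U (partial i u)
  end.

Definition smooth_on U u : Prop := forall k, class_C k U u.

(* A domain (nonempty connected open set) with C^infinity boundary: near each
   boundary point Omega is one side of a regular level set. *)
Definition smooth_domain (Omega : set 'rV[R]_n) : Prop :=
  [/\ open Omega, connected Omega, Omega !=set0 &
    forall z, (closure Omega `\` Omega) z ->
      exists (U : set 'rV[R]_n) (rho : 'rV[R]_n -> R),
        [/\ open U, U z, smooth_on U rho,
            (exists i, partial i rho z != 0) &
            Omega `&` U = [set x | U x /\ rho x < 0]]].

End differential_calculus.

Section heat.
Context {R : realType} {n : nat}.
Implicit Types (Omega : set 'rV[R]_n) (K : R -> 'rV[R]_n -> 'rV[R]_n -> R).

(* K t x y is the Dirichlet heat kernel K(t, x, y) of Omega, i.e. the kernel of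
   the symmetric sub-Markovian semigroup that solves the heat equation in Omega,
   vanishes on the boundary and tends to the identity as t -> 0+. On a smooth
   domain, bounded or not, these conditions have exactly one solution. Only the
   values at t > 0 and x, y in Omega matter. *)
Record dirichlet_heat_kernel Omega K : Prop := {
  dhk_ge0 : forall (t : R) x y, 0 < t -> Omega x -> Omega y -> 0 <= K t x y ;
  dhk_continuous : forall (t : R) x y, 0 < t -> Omega x -> Omega y ->
    {for (t, x, y), continuous
      (fun p : R * 'rV[R]_n * 'rV[R]_n => K p.1.1 p.1.2 p.2)} ;
  dhk_C2 : forall (t : R) y, 0 < t -> Omega y ->
    class_C 2 Omega (fun x => K t x y) ;
  dhk_heat : forall (t : R) x y, 0 < t -> Omega x -> Omega y ->
    is_derive t (1 : R) (fun s => K s x y) (laplacian (fun z => K t z y) x) ;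
  dhk_boundary : forall (t : R) y z, 0 < t -> Omega y ->
    (closure Omega `\` Omega) z ->
    K t x y @[x --> within Omega (nbhs z)] --> (0 : R) ;
  dhk_initial : forall (u : 'rV[R]_n -> R) x, continuous u ->
    (exists M, forall y, `|u y| <= M) -> Omega x ->
    (\int[lebesgue_rV R n]_(y in Omega) (K t x y * u y)%:E)%E @[t --> 0^'+]
      --> (u x)%:E ;
  dhk_symmetric : forall (t : R) x y, 0 < t -> Omega x -> Omega y ->
    K t x y = K t y x ;
  dhk_subMarkov : forall (t : R) x, 0 < t -> Omega x ->
    (\int[lebesgue_rV R n]_(y in Omega) (K t x y)%:E <= 1)%E ;
  dhk_semigroup : forall (s t : R) x y, 0 < s -> 0 < t -> Omega x -> Omega y ->
    (K (s + t) x y)%:E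
      = (\int[lebesgue_rV R n]_(z in Omega) (K s x z * K t z y)%:E)%E
}.

(* Extended-real valued, since it is also applied to the functions f(v(s)),
   which need not be integrable; S(0) is the identity. *)
Definition heat_semigroup Omega K (t : R) (u : 'rV[R]_n -> \bar R)
    (x : 'rV[R]_n) : \bar R :=
  if t == 0 then u x
  else (\int[lebesgue_rV R n]_(y in Omega) ((K t x y)%:E * u y))%E.

(* L^1_+(Omega); every class has a Borel representative. *)
Definition L1_nonneg Omega (u : 'rV[R]_n -> R) : Prop :=
  (lebesgue_rV R n).-integrable Omega (EFin \o u) /\
  {ae lebesgue_rV R n, forall x, Omega x -> 0 <= u x}.

(* The quotients u = a / b this is applied to are those of \bar R, where
   0 / 0 = 0 and a / 0 = +oo for a > 0: the norm is then the least C >= 0 such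
   that a <= C * b almost everywhere in Omega (for 0 <= a, b < +oo). *)
Definition Linfty_norm Omega (u : 'rV[R]_n -> \bar R) : \bar R :=
  'N[lebesgue_rV R n]_+oo[u \_ Omega]%E.

Definition cylinder Omega (T : R) : set ('rV[R]_n * R) := Omega `*` `]0, T[.

Definition measurable_nonneg Omega T (v : 'rV[R]_n * R -> \bar R) : Prop :=
  [/\ measurable_fun (cylinder Omega T) v,
      forall p, cylinder Omega T p -> (0 <= v p)%E &
      {ae (lebesgue_rV R n \x @lebesgue_measure R)%E,
        forall p, cylinder Omega T p -> v p \is a fin_num}].

(* F[v](t) at x; f is applied to real values, hence [fine]: the functions v of
   interest are finite almost everywhere. *)
Definition duhamel Omega K (f : R -> R) (phi : 'rV[R]_n -> R)
    (v : 'rV[R]_n * R -> \bar R) (p : 'rV[R]_n * R) : \bar R :=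
  (heat_semigroup Omega K p.2 (EFin \o phi) p.1 +
   \int[@lebesgue_measure R]_(s in `[0%R, p.2])
     heat_semigroup Omega K (p.2 - s) (fun y => (f (fine (v (y, s))))%:E) p.1)%E.

Definition supersolution Omega K f phi T (w : 'rV[R]_n * R -> \bar R) : Prop :=
  measurable_nonneg Omega T w /\
  {ae (lebesgue_rV R n \x @lebesgue_measure R)%E,
    forall p, cylinder Omega T p ->
      (duhamel Omega K f phi w p <= w p)%E}.

End heat.

(* Main.v *)
(* Write P(t) = S(t) phi, Q(t) = S(t) psi, H(t) = int_0^t h and w = P + Q H. The
   second hypothesis gives Q H <= (A - 1) g(Q), hence w <= A g(Q), and by
   monotonicity and the definition of h, f(w(s)) <= f(A g(Q(s))) <= h(s) Q(s).
   By the semigroup law S(t - s) f(w(s)) <= h(s) S(t - s) Q(s) = h(s) Q(t);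
   integrating over s gives F[w](t) <= P(t) + Q(t) H(t) = w(t).

   As g is arbitrary, h need not be measurable, and the integral of a nonnegative
   nonmeasurable function is the supremum over the simple functions below it.
   This lower integral is still monotone and homogeneous, which is all the
   argument uses. *)

Require Import Defs.
From mathcomp Require Import all_boot all_order all_algebra.
From mathcomp Require Import all_classical all_reals all_analysis.
From mathcomp Require Import measurable_realfun ess_sup_inf.

Set Implicit Arguments.
Unset Strict Implicit.
Unset Printing Implicit Defensive.

Import Order.TTheory GRing.Theory Num.Theory.
Import numFieldNormedType.Exports.

Local Open Scope classical_set_scope.
Local Open Scope ring_scope.

(** * Lower integrals of functions that may be nonmeasurable *)

Section lower_integral.
Context d {T : measurableType d} {R : realType}.
Variable mu : {measure set T -> \bar R}.
Implicit Types (D : set T) (f : T -> \bar R).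
Local Open Scope ereal_scope.
Import HBNNSimple.

Lemma ge0_integral_leP D f M : (forall x, D x -> 0 <= f x) ->
  (forall k : {nnsfun T >-> R}, (forall x, (k x)%:E <= (f \_ D) x) ->
    \int[mu]_x (k x)%:E <= M) ->
  \int[mu]_(x in D) f x <= M.
Proof.
move=> f0 kM; rewrite ge0_integralE//; apply: ge_ereal_sup => _ /= [k kf <-].
by rewrite -integralT_nnsfun; exact: kM.
Qed.

Lemma nnsfun_integral_le D f (k : {nnsfun T >-> R}) :
  (forall x, D x -> 0 <= f x) -> (forall x, (k x)%:E <= (f \_ D) x) ->
  \int[mu]_x (k x)%:E <= \int[mu]_(x in D) f x.
Proof.
move=> f0 kf; rewrite integralT_nnsfun ge0_integralE//.
by apply: ereal_sup_ubound; exists k.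
Qed.

(** Dropping the negative part of [f1] only increases its integral. A simple function below [f1^\+],
    cut off on the exceptional null set, keeps its integral and lies below [f2], so the suprema
    compare. *)
Lemma ae_le_lower_integral D f1 f2 : (forall x, D x -> 0 <= f2 x) ->
  {ae mu, forall x, D x -> f1 x <= f2 x} ->
  \int[mu]_(x in D) f1 x <= \int[mu]_(x in D) f2 x.
Proof.
move=> f20 f12; apply: (@le_trans _ _ (\int[mu]_(x in D) f1^\+ x)).
  by rewrite [leLHS]integralE geeDl ?oppe_le0 ?integral_ge0.
have [N [mN N0 {}f12]] : {ae mu, forall x, D x -> f1^\+ x <= f2 x}.
  by apply: filterS f12 => x f12 Dx; rewrite funeposE ge_max f12// f20.
apply: ge0_integral_leP => // k kf.
pose k' := proj_nnsfun k (measurableC mN).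
have -> : \int[mu]_x (k x)%:E = \int[mu]_x (k' x)%:E.
  apply: ae_eq_integral => //; try exact/measurable_EFinP.
  exists N; split => // x /= /not_implyP[_] kk'.
  by apply: contrapT => Nx; apply: kk'; rewrite mindicE mem_set//= mulr1.
apply: nnsfun_integral_le => // x /=; rewrite mindicE.
have [/set_mem Nx|Nx] := boolP (x \in ~` N); last first.
  by rewrite mulr0; exact: erestrict_ge0.
rewrite mulr1 (le_trans (kf x))// /patch; case: ifPn => // /set_mem Dx.
by apply: contrapT => ?; apply: Nx; apply: f12 => /= /(_ Dx).
Qed.

Lemma ae_eq_lower_integral D f1 f2 :
  {ae mu, forall x, D x -> f1 x = f2 x} ->
  \int[mu]_(x in D) f1 x = \int[mu]_(x in D) f2 x.
Proof.
move=> f12; rewrite integralE [RHS]integralE.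
by congr (_ - _); apply/le_anti/andP; split; apply: ae_le_lower_integral => //;
  apply: filterS f12 => x f12 Dx; rewrite ?funeposE ?funenegE f12.
Qed.

(** For [c > 0], a simple function below [c * f] becomes one below [f] after division by [c]. *)
Lemma lower_integralZl_le D (c : R) f :
  (0 <= c)%R -> (forall x, D x -> 0 <= f x) ->
  \int[mu]_(x in D) (c%:E * f x) <= c%:E * \int[mu]_(x in D) f x.
Proof.
rewrite le_eqVlt => /predU1P[<- _|c0 f0].
  by under eq_integral do rewrite mul0e; rewrite integral0 mul0e.
apply: ge0_integral_leP => [x Dx|k kf].
  by rewrite mule_ge0 ?lee_fin ?(ltW c0)//; exact: f0.
have c'0 : (0 <= c^-1)%R by rewrite invr_ge0 ltW.
pose k' := scale_nnsfun k c'0.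
have -> : \int[mu]_x (k x)%:E = c%:E * \int[mu]_x (k' x)%:E.
  rewrite -ge0_integralZl//; last by rewrite lee_fin ltW.
  - by apply: eq_integral => x _ /=; rewrite -EFinM mulVKf// gt_eqF.
  - exact/measurable_EFinP.
  - by move=> x _; rewrite lee_fin.
rewrite lee_pmul2l//; apply: nnsfun_integral_le => // x /=.
rewrite EFinM muleC -lee_pdivlMr ?invr_gt0// invrK muleC (le_trans (kf x))//.
by rewrite /patch; case: ifPn => //; rewrite mule0.
Qed.

End lower_integral.

(** * Measurability of open sets in R^n and in R x R^n x R^n *)

Section open_measurable.
Context {R : realType}.

Lemma open_setX (S T : topologicalType) (A : set S) (B : set T) :
  open A -> open B -> open (A `*` B).
Proof.
move=> oA oB; rewrite openE => -[x y] [/= Ax By].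
by exists (A, B) => //; split; exact: open_nbhs_nbhs.
Qed.

(** A ball of radius below [e / 2] whose centre is that close to [x] contains [x] and stays within
    [e] of it. With rational centres the union is countable. *)
Lemma open_bigcup_ball (T : pseudoMetricType R) (I : Type) (c : I -> T)
    (U : set T) :
  (forall x e, 0 < e -> exists i, ball x e (c i)) -> open U ->
  U = \bigcup_(p in [set p : I * nat | ball (c p.1) p.2.+1%:R^-1 `<=` U])
        ball (c p.1) p.2.+1%:R^-1.
Proof.
move=> c_dense oU; apply/seteqP; split => [x Ux|x [p /=]]; last exact.
have /nbhs_ballP[e /= e0 xeU] : nbhs x U by exact: open_nbhs_nbhs.
have [k ke] : exists k, k.+1%:R^-1 < e / 2.
  have e2 : 0 < e / 2 by rewrite divr_gt0.
  exists (Num.truncn (e / 2)^-1); rewrite invf_plt ?posrE//.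
  by rewrite truncnS_gt.
have [i xi] := c_dense x k.+1%:R^-1 ltac:(by rewrite invr_gt0).
exists (i, k) => /=; last exact: ball_sym.
move=> y cy; apply: xeU; rewrite (splitr e).
by apply: (@ball_triangle _ _ (c i)); apply: le_ball (ltW ke) _ _.
Qed.

Lemma ball_rat_rV n (x : 'rV[R]_n) e : 0 < e ->
  exists q : 'rV[rat]_n, ball x e (map_mx ratr q).
Proof.
move=> e0.
have q_ i : {q : rat | ball (x ord0 i) e (ratr q : R)}.
  apply/cid; have : x ord0 i - e < x ord0 i + e by rewrite ltrD2l gtrN.
  move=> /rat_in_itvoo[q]; rewrite in_itv/= => /andP[q1 q2]; exists q.
  by rewrite -ball_normE/= ltr_distlC q1 q2.
exists (\row_i sval (q_ i)); split => // i j.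
by rewrite !ord1 !mxE; exact: svalP (q_ j).
Qed.

Lemma ball_rVE n (x : 'rV[R]_n) e : 0 < e ->
  ball x e = [set y | forall i, ball (x ord0 i) e (y ord0 i)].
Proof.
move=> e0; apply/seteqP; split => y /=.
  by move=> [_ xy] i; exact: xy.
by move=> xy; split => // i j; rewrite !ord1.
Qed.

Lemma measurable_ball_rV n (x : 'rV[R]_n) e : measurable (ball x e).
Proof.
have [e0|e0] := ltP 0 e.
  rewrite ball_rVE//.
  apply: (@measurable_box _ _ (fun i => ball (x ord0 i) e)) => i.
  exact: measurable_ball.
(* Membership in a matrix ball includes [0 < e], so this ball is empty even for [n = 0]. *)
rewrite (_ : ball x e = set0)//; apply/seteqP; split => // y [/lt_geF].
by rewrite e0.
Qed.

Lemma open_measurable_rV n (U : set 'rV[R]_n) : open U -> measurable U.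
Proof.
pose c : 'rV[rat]_n -> 'rV[R]_n := map_mx ratr.
move=> oU; rewrite (@open_bigcup_ball 'rV[R]_n _ c U)//.
  rewrite bigcup_mkcond; apply: countable_bigcupT_measurable => // p.
  by case: ifP => // _; exact: measurable_ball_rV.
exact: ball_rat_rV.
Qed.

Lemma open_measurable_R_rV2 n (U : set (R * 'rV[R]_n * 'rV[R]_n)) :
  open U -> measurable U.
Proof.
move=> oU.
pose c (q : rat * 'rV[rat]_n * 'rV[rat]_n) : R * 'rV[R]_n * 'rV[R]_n :=
  (ratr q.1.1, map_mx ratr q.1.2, map_mx ratr q.2).
rewrite (@open_bigcup_ball (R * 'rV[R]_n * 'rV[R]_n)%type _ c U)//.
  rewrite bigcup_mkcond; apply: countable_bigcupT_measurable => // p.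
  case: ifP => // _.
  by apply: measurableX; [apply: measurableX|];
   [exact: measurable_ball|exact: measurable_ball_rV..].
move=> [[t x] y] e e0.
have [q1 xq] := ball_rat_rV x e0.
have [q2 yq] := ball_rat_rV y e0.
have : t - e < t + e by rewrite ltrD2l gtrN.
move=> /rat_in_itvoo[q]; rewrite in_itv/= => /andP[tq1 tq2].
exists (q, q1, q2); split => //; split => //=.
by rewrite -ball_normE/= ltr_distlC tq1 tq2.
Qed.

End open_measurable.

(** * The heat semigroup on nonnegative measurable functions *)

Section heat_semigroup_theory.
Context {R : realType} {n : nat}.
Variables (Omega : set 'rV[R]_n) (K : R -> 'rV[R]_n -> 'rV[R]_n -> R).
Hypotheses (oOmega : open Omega) (hK : dirichlet_heat_kernel Omega K).
Let mu := lebesgue_rV R n.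

(* K is unconstrained off ]0, +oo[ x Omega x Omega; cutting it off there makes
   it a nonnegative Borel function on the whole space. *)
Definition cut_kernel : R * 'rV[R]_n * 'rV[R]_n -> R :=
  (fun p => K p.1.1 p.1.2 p.2) \_ (`]0, +oo[ `*` Omega `*` Omega).

Lemma cut_kernelE t x y : 0 < t -> Omega x -> Omega y ->
  cut_kernel (t, x, y) = K t x y.
Proof.
move=> t0 Ox Oy; rewrite /cut_kernel patchE ifT// inE; split => //.
by split => //=; rewrite in_itv/= t0.
Qed.

Lemma cut_kernel_outl t x y : ~ Omega x -> cut_kernel (t, x, y) = 0.
Proof.
by move=> nOx; rewrite /cut_kernel patchE ifF//; apply/negP; rewrite inE => -[[]].
Qed.

Lemma cut_kernel_outr t x y : ~ Omega y -> cut_kernel (t, x, y) = 0.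
Proof.
by move=> nOy; rewrite /cut_kernel patchE ifF//; apply/negP; rewrite inE => -[].
Qed.

Lemma cut_kernel_ge0 p : 0 <= cut_kernel p.
Proof.
case: p => -[t x] y; rewrite /cut_kernel patchE; case: ifPn => //.
rewrite inE => -[[/= + Ox] Oy]; rewrite in_itv/= andbT => t0.
exact: dhk_ge0 hK _ _ _ t0 Ox Oy.
Qed.

(** The cut-off region is open and [K] is continuous at each of its points, so its points sent into
    an open interval form an open set. *)
Lemma measurable_cut_kernel : measurable_fun setT cut_kernel.
Proof.
have oD : open (`]0%R, +oo[%classic `*` Omega `*` Omega :
    set (R * 'rV[R]_n * 'rV[R]_n)).
  by apply: open_setX => //; apply: open_setX.
apply/(measurable_restrictT _ (open_measurable_R_rV2 oD)).
apply: (measurability _ (RGenOpens.measurableE R)) => _ [_ [a [b ->] <-]].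
apply: open_measurable_R_rV2; rewrite openE => -[[t x] y] /= [Dp abp].
apply: filterI; first exact: open_nbhs_nbhs.
case: (Dp) => -[/= + Ox] Oy; rewrite in_itv/= andbT => t0.
apply: (dhk_continuous hK t0 Ox Oy).
by apply: open_nbhs_nbhs; split => //; exact: interval_open.
Qed.

Lemma measurable_cut_kernelM d (S : measurableType d) (t : S -> R)
    (x y : S -> 'rV[R]_n) (v : S -> \bar R) :
  measurable_fun setT t -> measurable_fun setT x -> measurable_fun setT y ->
  measurable_fun setT v ->
  measurable_fun setT (fun s => ((cut_kernel (t s, x s, y s))%:E * v s)%E).
Proof.
move=> mt mx my mv; apply: emeasurable_funM => //.
apply/measurable_EFinP; apply: (measurableT_comp measurable_cut_kernel).
by apply: measurable_fun_pair => //; exact: measurable_fun_pair.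
Qed.

Lemma measurable_cut_kernell t y :
  measurable_fun setT (fun x => (cut_kernel (t, x, y))%:E).
Proof.
apply/measurable_EFinP; apply: (measurableT_comp measurable_cut_kernel).
by apply: measurable_fun_pair => //; exact: measurable_fun_pair.
Qed.

(** The sub-Markov bound controls the integral in the second space variable; symmetry transfers it
    to the first. *)
Lemma integral_cut_kernel_le1 t y : 0 < t ->
  (\int[mu]_x (cut_kernel (t, x, y))%:E <= 1)%E.
Proof.
move=> t0; have [Oy|nOy] := pselect (Omega y); last first.
  under eq_integral do rewrite cut_kernel_outr//.
  by rewrite integral0 lee01.
apply: le_trans (dhk_subMarkov hK t0 Oy).
rewrite [leRHS]integral_mkcond le_eqVlt; apply/orP; left; apply/eqP.
apply: eq_integral => x _; rewrite patchE; case: ifPn => [/set_mem Ox|/negP nOx].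
  by rewrite cut_kernelE// (dhk_symmetric hK).
by rewrite cut_kernel_outl// => Ox; apply: nOx; rewrite inE.
Qed.

(** Integrating over the whole space puts the iterated integrals in the form of Tonelli's theorem.
    At [t <= 0] this operator is zero, not the identity. *)
Definition cut_semigroup (t : R) (u : 'rV[R]_n -> \bar R) (x : 'rV[R]_n) :=
  (\int[mu]_y ((cut_kernel (t, x, y))%:E * u y))%E.

Lemma heat_semigroupE t u x : 0 < t -> Omega x ->
  heat_semigroup Omega K t u x = cut_semigroup t u x.
Proof.
move=> t0 Ox; rewrite /heat_semigroup gt_eqF// integral_mkcond.
apply: eq_integral => y _; rewrite patchE; case: ifPn => [/set_mem Oy|/negP nOy].
  by rewrite cut_kernelE.
by rewrite cut_kernel_outr ?mul0e// => Oy; apply: nOy; rewrite inE.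
Qed.

(** Rests on [K >= 0] and monotonicity of the lower integral; it serves to insert the almost
    everywhere bound on f(w(s)). *)
Lemma le_heat_semigroup t u v x : 0 < t -> Omega x ->
  (forall y, Omega y -> 0 <= v y)%E ->
  {ae mu, forall y, Omega y -> (u y <= v y)%E} ->
  (heat_semigroup Omega K t u x <= heat_semigroup Omega K t v x)%E.
Proof.
move=> t0 Ox v0 uv; rewrite /heat_semigroup gt_eqF//.
have K0 y : Omega y -> (0 <= (K t x y)%:E)%E.
  by move=> Oy; rewrite lee_fin; exact: dhk_ge0 hK _ _ _ t0 Ox Oy.
apply: ae_le_lower_integral => [y Oy|]; first by rewrite mule_ge0 ?K0 ?v0.
by apply: filterS uv => y uv Oy; rewrite lee_wpmul2l ?K0// uv.
Qed.

Section nonnegative_measurable.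
Variable u : 'rV[R]_n -> \bar R.
Hypotheses (measurable_u : measurable_fun setT u) (u0 : forall y, (0 <= u y)%E).

Lemma cut_semigroup_ge0 t x : (0 <= cut_semigroup t u x)%E.
Proof.
by apply: integral_ge0 => y _; rewrite mule_ge0// lee_fin cut_kernel_ge0.
Qed.

Lemma measurable_cut_semigroup :
  measurable_fun setT (fun p : 'rV[R]_n * R => cut_semigroup p.2 u p.1).
Proof.
apply: (@measurable_fun_fubini_tonelli_F _ _ _ _ _ mu
  (fun q : ('rV[R]_n * R) * 'rV[R]_n =>
    ((cut_kernel (q.1.2, q.1.1, q.2))%:E * u q.2)%E)).
  apply: measurable_cut_kernelM => //; try exact: measurableT_comp.
by move=> q; rewrite mule_ge0// lee_fin cut_kernel_ge0.
Qed.

Lemma measurable_cut_semigroup_slice t : measurable_fun setT (cut_semigroup t u).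
Proof.
apply: (measurableT_comp measurable_cut_semigroup (g := fun x => (x, t))).
exact: measurable_fun_pair.
Qed.

(** By Tonelli the integral in [x] falls on the kernel alone, whose mass is at most 1. *)
Lemma cut_semigroup_contractive t : 0 < t ->
  (\int[mu]_x cut_semigroup t u x <= \int[mu]_x u x)%E.
Proof.
move=> t0.
pose F q := ((cut_kernel (t, q.1, q.2))%:E * u q.2)%E.
have F0 q : (0 <= F q)%E by rewrite mule_ge0// lee_fin cut_kernel_ge0.
have mF : measurable_fun setT F.
  by apply: measurable_cut_kernelM => //; exact: measurableT_comp.
rewrite /cut_semigroup (fubini_tonelli F)//.
apply: ge0_le_integral => //.
- by move=> y _; apply: integral_ge0.
- exact: (measurable_fun_fubini_tonelli_G (m1 := mu)).
- move=> y _; rewrite /F/= ge0_integralZr//.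
  + by rewrite -[leRHS]mul1e lee_wpmul2r// integral_cut_kernel_le1.
  + exact: measurable_cut_kernell.
  + by move=> x _; rewrite lee_fin cut_kernel_ge0.
Qed.

Lemma cut_semigroupZ c t x : (0 <= c)%E ->
  cut_semigroup t (fun y => (c * u y)%E) x = (c * cut_semigroup t u x)%E.
Proof.
move=> c0; rewrite /cut_semigroup -ge0_integralZl//.
- by apply: eq_integral => y _; rewrite muleCA.
- exact: measurable_cut_kernelM.
- by move=> y _; rewrite mule_ge0// lee_fin cut_kernel_ge0.
Qed.

(** Tonelli moves the integral over the intermediate point onto the two kernels, where it is the
    Chapman-Kolmogorov identity [dhk_semigroup]. For [y] outside [Omega] both integrands vanish. *)
Lemma cut_semigroupD s t x : 0 < s -> 0 < t -> Omega x ->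
  cut_semigroup s (cut_semigroup t u) x = cut_semigroup (s + t) u x.
Proof.
move=> s0 t0 Ox; rewrite /cut_semigroup.
pose F q :=
  ((cut_kernel (s, x, q.1))%:E * ((cut_kernel (t, q.1, q.2))%:E * u q.2))%E.
have k0 p : (0 <= (cut_kernel p)%:E)%E by rewrite lee_fin cut_kernel_ge0.
have F0 q : (0 <= F q)%E by rewrite !mule_ge0.
have mF : measurable_fun setT F.
  by do 2![apply: measurable_cut_kernelM => //]; exact: measurableT_comp.
transitivity (\int[mu]_z \int[mu]_y F (z, y))%E.
  apply: eq_integral => z _; rewrite -ge0_integralZl// => [|y _].
    exact: measurable_cut_kernelM.
  by rewrite mule_ge0.
rewrite fubini_tonelli//; apply: eq_integral => y _; rewrite /F/=.
have [Oy|nOy] := pselect (Omega y); last first.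
  rewrite [in RHS]cut_kernel_outr// mul0e.
  under eq_integral do
    rewrite [cut_kernel (t, _, y)]cut_kernel_outr// mul0e mule0.
  exact: integral0.
under eq_integral do rewrite muleA.
rewrite ge0_integralZr//; last 2 first.
- by apply: measurable_cut_kernelM => //; exact: measurable_cut_kernell.
- by move=> z _; rewrite mule_ge0.
congr (_ * _)%E; rewrite cut_kernelE ?addr_gt0// (dhk_semigroup hK)//.
rewrite [RHS]integral_mkcond; apply: eq_integral => z _.
rewrite patchE; case: ifPn => [/set_mem Oz|/negP nOz].
  by rewrite !cut_kernelE// EFinM.
by rewrite cut_kernel_outr ?mul0e// => Oz; apply: nOz; rewrite inE.
Qed.

End nonnegative_measurable.
End heat_semigroup_theory.

(** * Monotone functions and null sets of product measures *)

(** Superlevel sets in [D] are intervals. This makes the integral of [h] up to [t] measurable in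
    [t]. *)
Lemma nondecreasing_measurable_ereal {R : realType} (D : set R) (H : R -> \bar R) :
  is_interval D -> {in D &, {homo H : s t / s <= t >-> (s <= t)%E}} ->
  measurable_fun D H.
Proof.
move=> iD ndH.
apply: (measurability _ (ErealGenOInfty.measurableE R)) => /= _ [_ [r ->] <-].
apply: is_interval_measurable => s t /= [Ds]; rewrite !in_itv/= !andbT => rs.
move=> [Dt rt] u /andP[su ut].
have Du : D u by apply: (iD s t) => //; rewrite su ut.
split => //; rewrite in_itv/= andbT (lt_le_trans rs)//.
by apply: ndH => //; rewrite inE.
Qed.

(** [\x] integrates the measures of x-sections; uniqueness of the product measure trades it for
    [\x^], which integrates those of y-sections, here the slices at fixed time. *)
Lemma product_measure_null_ysections d1 d2 (T1 : measurableType d1)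
    (T2 : measurableType d2) (R : realType)
    (m1 : {sigma_finite_measure set T1 -> \bar R})
    (m2 : {sigma_finite_measure set T2 -> \bar R}) (B : set (T1 * T2)) :
  measurable B -> (forall y, m1 (ysection B y) = 0%E) -> (m1 \x m2)%E B = 0%E.
Proof.
move=> mB B0; rewrite (@product_measure_unique _ _ _ _ _ m1 m2 (m1 \x^ m2)%E)//.
  rewrite /= /product_measure2; under eq_integral do rewrite /= B0.
  by rewrite integral0.
by move=> A C mA mC; exact: product_measure2E.
Qed.

(** * Pointwise consequences of the L^infinity bounds *)

Lemma Linfty_norm_ae {R : realType} {n} (Omega : set 'rV[R]_n)
    (u : 'rV[R]_n -> \bar R) :
  {ae lebesgue_rV R n, forall x, Omega x -> (u x <= Linfty_norm Omega u)%E}.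
Proof.
rewrite /Linfty_norm unlock; case: ltP => [_|le0].
  apply: filterS (ess_sup_ge (lebesgue_rV R n) (abse \o u \_ Omega)) => x + Ox.
  by apply: le_trans; rewrite /= patchE mem_set// lee_abs.
(* In this branch the norm is 0 by convention, but the whole space is null. *)
exists setT; split => //.
by apply/eqP; rewrite eq_le measure_ge0 andbT.
Qed.

Lemma Linfty_norm_ge0 {R : realType} {n} (Omega : set 'rV[R]_n)
    (u : 'rV[R]_n -> \bar R) : (0 <= Linfty_norm Omega u)%E.
Proof. exact: Lnorm_ge0. Qed.

(** If [b = 0 < q], the quotient is infinite, so [N = +oo] and the bound by [A] forces [H = 0]. If
    [b > 0], write [q] as [b * (q / b)] and use [N * H <= A - 1]. *)
Lemma mule_le_of_quotient_bound {R : realType} (q b A : R) (N H : \bar R) :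
  0 <= q -> 0 <= b -> 1 <= A -> (0 <= N)%E -> (0 <= H)%E ->
  (q%:E / b%:E <= N)%E -> (1 + N * H <= A%:E)%E ->
  (q%:E * H <= ((A - 1) * b)%:E)%E.
Proof.
rewrite le_eqVlt => /predU1P[<- b0 A1 _ _ _ _|q0].
  by rewrite mul0e lee_fin mulr_ge0// subr_ge0.
rewrite le_eqVlt => /predU1P[<-|b0] A1 N0 H0 qN NHA.
  move: qN NHA; rewrite inve0 gt0_muley ?lte_fin// leye_eq => /eqP ->.
  move: H0; rewrite le_eqVlt => /predU1P[<- _|H0]; first by rewrite mule0 mulr0.
  by rewrite gt0_mulye.
have {}NHA : ((q / b)%:E * H <= (A - 1)%:E)%E.
  rewrite EFinB leeBrDl//; apply: le_trans NHA; rewrite leeD2l//.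
  by apply: lee_wpmul2r => //; move: qN; rewrite inver gt_eqF.
have -> : q%:E = (b%:E * (q / b)%:E)%E by rewrite -EFinM mulrC divfK ?gt_eqF.
by rewrite -muleA [(A - 1) * b]mulrC [leRHS]EFinM lee_wpmul2l// lee_fin ltW.
Qed.

Lemma EFin_le_of_quotient_le {R : realType} (a q c : R) :
  0 <= a -> 0 <= q -> (a%:E / q%:E <= c%:E)%E -> (a <= c * q).
Proof.
move=> a0; rewrite le_eqVlt => /predU1P[<-|q0].
  move: a0; rewrite le_eqVlt => /predU1P[<-|a0]; first by rewrite mulr0.
  by rewrite inve0 gt0_muley ?lte_fin.
by rewrite inver gt_eqF// -EFinM lee_fin ler_pdivrMr.
Qed.

(** Here [p], [q], [H], [c] stand for P(t), Q(t), H(t), h(t). The bound of [p + q * H] by [A * g q]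
    also gives finiteness, so [fine] loses nothing inside [f]. *)
Lemma nonlinearity_slice_bound {R : realType} {n} (Omega : set 'rV[R]_n)
    (f g : R -> R) (A c : R) (H : \bar R) (p q : 'rV[R]_n -> \bar R) :
  1 <= A -> (0 <= H)%E ->
  (forall u, 0 <= u -> 0 <= f u) ->
  (forall u v, 0 <= u -> u <= v -> f u <= f v) ->
  (forall u, 0 <= u -> 0 <= g u) ->
  {ae lebesgue_rV R n, forall x, Omega x ->
    [/\ (0 <= p x)%E, (0 <= q x)%E, q x \is a fin_num &
        (p x <= (g (fine (q x)))%:E)%E]} ->
  (1 + Linfty_norm Omega (fun x => q x / (g (fine (q x)))%:E) * H <= A%:E)%E ->
  c%:E = Linfty_norm Omega (fun x => ((f (A * g (fine (q x))))%:E / q x)%E) ->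
  {ae lebesgue_rV R n, forall x, Omega x ->
    (p x + q x * H)%E \is a fin_num /\
    ((f (fine (p x + q x * H)))%:E <= c%:E * q x)%E}.
Proof.
move=> A1 H0 f0 ndf g0 pq NHA ch.
have := Linfty_norm_ae Omega (fun x => (q x / (g (fine (q x)))%:E)%E).
have := Linfty_norm_ae Omega (fun x => ((f (A * g (fine (q x))))%:E / q x)%E).
rewrite -ch; apply: filterS3 pq => x pqx fx Nx Ox.
have [p0 q0 qfin pg] := pqx Ox.
have {fx}/= := fx Ox; have {Nx}/= := Nx Ox.
move: q0 pg; rewrite -(fineK qfin) /= lee_fin; set q1 := fine (q x) => q0 pg Nq fq.
have qH := mule_le_of_quotient_bound q0 (g0 _ q0) A1 (Linfty_norm_ge0 _ _) H0 Nq NHA.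
have qH0 : (0 <= q1%:E * H)%E by rewrite mule_ge0.
have w0 : (0 <= p x + q1%:E * H)%E by rewrite adde_ge0.
have wA : (p x + q1%:E * H <= (A * g q1)%:E)%E.
  by rewrite -[A](subrK 1) mulrDl mul1r addrC EFinD leeD.
have wfin : (p x + q1%:E * H)%E \is a fin_num.
  by rewrite ge0_fin_numE// (le_lt_trans wA)// ltry.
split => //; rewrite -EFinM lee_fin.
apply: le_trans (EFin_le_of_quotient_le _ q0 fq).
  by rewrite ndf ?fine_ge0// -lee_fin fineK.
by rewrite f0// mulr_ge0 ?(le_trans _ A1)// g0.
Qed.

(** * Orbits of nonnegative integrable data *)

Section nonnegative_representative.
Context {R : realType} {n : nat}.
Variables (Omega : set 'rV[R]_n) (K : R -> 'rV[R]_n -> 'rV[R]_n -> R).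
Hypotheses (oOmega : open Omega) (hK : dirichlet_heat_kernel Omega K).
Let mu := lebesgue_rV R n.
Let mOmega : measurable Omega := open_measurable_rV oOmega.
Variable u : 'rV[R]_n -> R.
Hypothesis L1u : L1_nonneg Omega u.

(* S(t) depends only on the a.e. class of u when t > 0, so u may be replaced by
   this everywhere nonnegative Borel representative. *)
Definition nonneg_rep : 'rV[R]_n -> \bar R := ((EFin \o u)^\+)%E \_ Omega.

Lemma nonneg_rep_ge0 y : (0 <= nonneg_rep y)%E.
Proof. by apply: erestrict_ge0 => *; exact: funepos_ge0. Qed.

Lemma measurable_nonneg_rep : measurable_fun setT nonneg_rep.
Proof.
apply/(measurable_restrictT _ mOmega).
by apply: measurable_funepos; exact: measurable_int L1u.1.
Qed.

Lemma integral_nonneg_rep_lty : (\int[mu]_y nonneg_rep y < +oo)%E.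
Proof.
rewrite -integral_mkcond; apply: integrable_lty => //.
by apply: integrable_funepos => //; exact: L1u.1.
Qed.

Lemma nonneg_repE : {ae mu, forall y, Omega y -> (u y)%:E = nonneg_rep y}.
Proof.
apply: filterS L1u.2 => y u0 Oy.
rewrite /nonneg_rep patchE mem_set// funeposE/=.
by apply/esym/max_idPl; rewrite lee_fin u0.
Qed.

Lemma heat_semigroup_nonneg_rep t x : 0 < t -> Omega x ->
  heat_semigroup Omega K t (EFin \o u) x = cut_semigroup Omega K t nonneg_rep x.
Proof.
move=> t0 Ox; rewrite -heat_semigroupE// /heat_semigroup gt_eqF//.
by apply: ae_eq_lower_integral; apply: filterS nonneg_repE => y e Oy; rewrite -e.
Qed.

Definition heat_rep (t : R) : 'rV[R]_n -> \bar R :=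
  if t == 0 then nonneg_rep else cut_semigroup Omega K t nonneg_rep.

Lemma heat_rep_ge0 t y : (0 <= heat_rep t y)%E.
Proof.
rewrite /heat_rep; case: ifP => _; first exact: nonneg_rep_ge0.
by apply: cut_semigroup_ge0 => // z; exact: nonneg_rep_ge0.
Qed.

Lemma measurable_heat_rep t : measurable_fun setT (heat_rep t).
Proof.
rewrite /heat_rep; case: ifP => _; first exact: measurable_nonneg_rep.
apply: measurable_cut_semigroup_slice => //; first exact: measurable_nonneg_rep.
exact: nonneg_rep_ge0.
Qed.

(** For [t > 0] the equality holds at every point of [Omega]; only at [t = 0], where S(0) is the
    identity, is a null set lost. *)
Lemma heat_repE t : 0 <= t -> {ae mu, forall y, Omega y ->
  heat_semigroup Omega K t (EFin \o u) y = heat_rep t y}.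
Proof.
rewrite /heat_rep le_eqVlt => /predU1P[<-|t0].
  by rewrite /heat_semigroup eqxx; exact: nonneg_repE.
by apply: aeW => y Oy; rewrite gt_eqF// heat_semigroup_nonneg_rep.
Qed.

(** The [L^1] contraction makes [heat_rep t] integrable, hence finite almost everywhere. *)
Lemma heat_rep_fin_num t : 0 <= t -> {ae mu, forall y, heat_rep t y \is a fin_num}.
Proof.
move=> t0; suff : mu.-integrable setT (heat_rep t).
  by move=> /integrable_ae => /(_ measurableT); apply: filterS => y; exact.
apply/integrableP; split; first exact: measurable_heat_rep.
under eq_integral do rewrite gee0_abs ?heat_rep_ge0//.
apply: le_lt_trans integral_nonneg_rep_lty; rewrite /heat_rep.
case: eqVneq => // t_neq0; apply: cut_semigroup_contractive => //.
- exact: measurable_nonneg_rep.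
- exact: nonneg_rep_ge0.
- by rewrite lt_neqAle eq_sym t_neq0.
Qed.

(** The case [t = 0] covers the initial time of the Duhamel integral. *)
Lemma heat_repD s t x : 0 < s -> 0 <= t -> Omega x ->
  cut_semigroup Omega K s (heat_rep t) x = heat_rep (s + t) x.
Proof.
move=> s0 t0 Ox; have st0 : 0 < s + t by rewrite ltr_wpDr.
rewrite /heat_rep (gt_eqF st0).
move: t0; rewrite le_eqVlt => /predU1P[<-|t0]; first by rewrite eqxx addr0.
rewrite gt_eqF// cut_semigroupD//; first exact: measurable_nonneg_rep.
exact: nonneg_rep_ge0.
Qed.

Lemma heat_semigroup_measurable T : measurable_fun (cylinder Omega T)
  (fun p : 'rV[R]_n * R => heat_semigroup Omega K p.2 (EFin \o u) p.1).
Proof.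
apply: (eq_measurable_fun (fun p : 'rV[R]_n * R =>
    cut_semigroup Omega K p.2 nonneg_rep p.1)).
  move=> [x t]; rewrite inE => -[/= Ox]; rewrite in_itv/= => /andP[t0 _].
  by rewrite heat_semigroup_nonneg_rep.
apply: measurable_funTS; apply: measurable_cut_semigroup => //.
  exact: measurable_nonneg_rep.
exact: nonneg_rep_ge0.
Qed.

End nonnegative_representative.

(** * Measurability of [w] and the Duhamel estimate *)

Theorem proposition3p2 (R : realType) (n : nat) (hn : (0 < n)%N)
    (Omega : set 'rV[R]_n) (hOmega : smooth_domain Omega)
    (K : R -> 'rV[R]_n -> 'rV[R]_n -> R)
    (hK : dirichlet_heat_kernel Omega K)
    (f : R -> R)
    (f_ge0 : forall u, 0 <= u -> 0 <= f u)
    (f_cont : {within `[0, +oo[, continuous f})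
    (f_nondecr : forall u v, 0 <= u -> u <= v -> f u <= f v)
    (phi : 'rV[R]_n -> R) (hphi : L1_nonneg Omega phi)
    (A T : R) (hA : 1 < A) (hT : 0 < T)
    (psi : 'rV[R]_n -> R) (hpsi : L1_nonneg Omega psi)
    (g : R -> R) (g_ge0 : forall u, 0 <= u -> 0 <= g u)
    (h : R -> R) (h_ge0 : forall t, 0 <= t <= T -> 0 <= h t)
    (hphig : forall t, 0 <= t <= T ->
      {ae lebesgue_rV R n, forall x, Omega x ->
        (heat_semigroup Omega K t (EFin \o phi) x
         <= (g (fine (heat_semigroup Omega K t (EFin \o psi) x)))%:E)%E})
    (hbound : forall t, 0 <= t <= T ->
      (1 + Linfty_norm Omega (fun x =>
             heat_semigroup Omega K t (EFin \o psi) x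
             / (g (fine (heat_semigroup Omega K t (EFin \o psi) x)))%:E)
           * \int[@lebesgue_measure R]_(s in `[0%R, t]) (h s)%:E
       <= A%:E)%E)
    (hh : forall t, 0 <= t <= T ->
      (h t)%:E = Linfty_norm Omega (fun x =>
        ((f (A * g (fine (heat_semigroup Omega K t (EFin \o psi) x))))%:E
         / heat_semigroup Omega K t (EFin \o psi) x)%E)) :
  supersolution Omega K f phi T (fun p : 'rV[R]_n * R =>
    (heat_semigroup Omega K p.2 (EFin \o phi) p.1
     + heat_semigroup Omega K p.2 (EFin \o psi) p.1
       * \int[@lebesgue_measure R]_(s in `[0%R, p.2]) (h s)%:E)%E).
Proof.
have oOmega : open Omega by case: hOmega.
have mOmega := open_measurable_rV oOmega.
set S := heat_semigroup Omega K.
pose H t := (\int[@lebesgue_measure R]_(s in `[0%R, t]) (h s)%:E)%E.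
pose w (p : 'rV[R]_n * R) : \bar R :=
  (S p.2 (EFin \o phi) p.1 + S p.2 (EFin \o psi) p.1 * H p.2)%E.
change (supersolution Omega K f phi T w).
have h0 t s : t <= T -> `[0, t]%classic s -> (0 <= (h s)%:E)%E.
  move=> tT /=; rewrite in_itv/= => /andP[s0 st].
  by rewrite lee_fin h_ge0// s0 (le_trans st).
have H0 t : t <= T -> (0 <= H t)%E.
  by move=> tT; apply: integral_ge0 => s; exact: h0.
have mH : measurable_fun `]0, T[ H.
  apply: nondecreasing_measurable_ereal; first exact: interval_is_interval.
  move=> s t _; rewrite inE/= in_itv/= => /andP[_ /ltW tT] st.
  rewrite /H integral_mkcond [leRHS]integral_mkcond.
  apply: ae_le_lower_integral => [u _|].
    by apply: erestrict_ge0 => v; exact: h0.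
  apply: aeW => u _; rewrite !patchE.
  case: ifPn => [/set_mem/=|_]; last first.
    by case: ifPn => // /set_mem; exact: h0.
  rewrite in_itv/= => /andP[u0 us]; rewrite mem_set//= in_itv/= u0/=.
  exact: le_trans st.
(* The bound is stated with the Borel version of Q(s), to which the semigroup law applies. *)
have slice s : 0 <= s <= T -> {ae lebesgue_rV R n, forall y, Omega y ->
    [/\ S s (EFin \o psi) y \is a fin_num, w (y, s) \is a fin_num &
        ((f (fine (w (y, s))))%:E <= (h s)%:E * heat_rep Omega K psi s y)%E]}.
  move=> /andP[s0 sT]; have s0T : 0 <= s <= T by rewrite s0.
  have pq : {ae lebesgue_rV R n, forall y, Omega y ->
    [/\ (0 <= S s (EFin \o phi) y)%E, (0 <= S s (EFin \o psi) y)%E,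
        S s (EFin \o psi) y \is a fin_num &
        (S s (EFin \o phi) y <= (g (fine (S s (EFin \o psi) y)))%:E)%E]}.
    apply: filterS3 (heat_rep_fin_num oOmega hK hpsi s0) (hphig s s0T)
      (filterI (heat_repE K hphi s0) (heat_repE K hpsi s0)).
    move=> y psi_fin phig [phiE psiE] Oy.
    have /= := phig Oy; rewrite -/S.
    have {phiE}/= := phiE Oy; have {psiE}/= := psiE Oy; rewrite -/S => -> -> pg.
    by split => //; exact: heat_rep_ge0.
  have := nonlinearity_slice_bound (ltW hA) (H0 _ sT) f_ge0 f_nondecr g_ge0 pq
    (hbound s s0T) (hh s s0T).
  have := heat_repE K hpsi s0.
  apply: filterS3 pq => y pq psiE fw Oy.
  have [_ _ psi_fin _] := pq Oy; have [w_fin fwh] := fw Oy.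
  by split => //; rewrite -psiE.
have mS u : L1_nonneg Omega u -> measurable_fun (cylinder Omega T)
    (fun p => S p.2 (EFin \o u) p.1).
  by move=> L1u; exact: heat_semigroup_measurable.
have mcyl : measurable (cylinder Omega T) by exact: measurableX.
have mw : measurable_fun (cylinder Omega T) w.
  apply: emeasurable_funD; first exact: mS.
  apply: emeasurable_funM; first exact: mS.
  (* Extension by zero makes [H] measurable on the whole time axis before composing with the
     projection. *)
  apply: (eq_measurable_fun (fun p => (H \_ `]0, T[) p.2)).
    by move=> [x t]; rewrite inE => -[_ /= tT]; rewrite patchE mem_set.
  apply: measurable_funTS; apply: measurableT_comp => //.
  by apply/(measurable_restrictT _ (measurable_itv `]0, T[)).
(* The estimate of F[w] below holds at every point of the cylinder where Q is
   finite, so the only null set to control is where Q or w is infinite: it is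
   Borel and its slices at fixed time are null. *)
pose good := (cylinder Omega T `&` [set p | w p \is a fin_num]) `&`
  (cylinder Omega T `&` [set p | S p.2 (EFin \o psi) p.1 \is a fin_num]).
have good_ae : {ae (lebesgue_rV R n \x @lebesgue_measure R)%E,
    forall p, cylinder Omega T p -> good p}.
  exists (cylinder Omega T `\` good); split.
  - apply: measurableD => //.
    by apply: measurableI; apply: emeasurable_fin_num => //; exact: mS.
  - apply: product_measure_null_ysections => [|t].
      apply: measurableD => //.
      by apply: measurableI; apply: emeasurable_fin_num => //; exact: mS.
    apply/negligibleP.
      apply: measurable_ysection; apply: measurableD => //.
      by apply: measurableI; apply: emeasurable_fin_num => //; exact: mS.
    have [tT|tT] := boolP (t \in `]0, T[).
      have /slice : 0 <= t <= T.
        by move: tT; rewrite in_itv/= => /andP[/ltW-> /ltW->].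
      apply: negligibleS => y; rewrite /ysection/= inE => -[cyl ngood] sl.
      have [? ? _] := sl cyl.1.
      by apply: ngood; split; split.
    rewrite (_ : ysection _ _ = set0); first exact: negligible_set0.
    apply/seteqP; split => // y; rewrite /ysection/= inE => -[[_ /= tT'] _].
    by rewrite tT' in tT.
  - by move=> p /= /not_implyP.
have FF : Filter (nbhs
    (almost_everywhere (lebesgue_rV R n \x @lebesgue_measure R)%E)).
  exact: ae_filter_ringOfSetsType.
split.
  split => //.
    move=> [x t] [/= Ox]; rewrite in_itv/= => /andP[t0 tT].
    have S0 u : L1_nonneg Omega u -> (0 <= S t (EFin \o u) x)%E.
      move=> L1u; rewrite /S heat_semigroup_nonneg_rep//.
      by apply: cut_semigroup_ge0 => // y; exact: nonneg_rep_ge0.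
    by rewrite /w/= adde_ge0 ?mule_ge0 ?S0 ?H0 ?(ltW tT).
  by apply: filterS good_ae => p gp /gp[[]].
apply: filterS good_ae => -[x t] gp /[dup] /gp[_ [_ /= psi_fin]].
move=> [/= Ox]; rewrite in_itv/= => /andP[t0 tT].
rewrite /duhamel /w/=; apply: leeD => //.
(* As [t > 0], the Borel version is exact at this very [x]; finiteness there makes Q(t) a real
   scalar, as homogeneity of the lower integral demands. *)
have psiE : S t (EFin \o psi) x = heat_rep Omega K psi t x.
  by rewrite /S heat_semigroup_nonneg_rep// /heat_rep gt_eqF.
rewrite psiE in psi_fin *; rewrite -(fineK psi_fin).
have q0 : 0 <= fine (heat_rep Omega K psi t x) by rewrite fine_ge0 ?heat_rep_ge0.
have h0t s : `[0, t]%classic s -> (0 <= (h s)%:E)%E by apply: h0; exact: ltW.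
apply: (le_trans _ (lower_integralZl_le lebesgue_measure q0 h0t)).
apply: ae_le_lower_integral => [s /h0t hs|]; first by rewrite mule_ge0// lee_fin.
(* Discards [s = t]: there S(0) is the identity, and an almost everywhere bound in space says
   nothing at the single point [x]. *)
exists [set t]; split => //; first exact: lebesgue_measure_set1.
move=> s /=; apply: contra_notP => st; rewrite in_itv/= => /andP[s0].
rewrite le_eqVlt => /predU1P[//|{}st].
have ts0 : 0 < t - s by rewrite subr_gt0.
have s0T : 0 <= s <= T by rewrite s0 (ltW (lt_trans st tT)).
have hs : (0 <= (h s)%:E)%E by rewrite lee_fin h_ge0.
apply: (@le_trans _ _ (S (t - s)
    (fun y => ((h s)%:E * heat_rep Omega K psi s y)%E) x)).
  apply: le_heat_semigroup => // [y _|].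
    by rewrite mule_ge0// heat_rep_ge0.
  by apply: filterS (slice s s0T) => y sl /sl[].
(* h(s) is constant in space and comes out; S(t - s) Q(s) = Q(t) then removes the other dependence
   on [s]. *)
rewrite /S heat_semigroupE// cut_semigroupZ//; last 2 first.
- exact: measurable_heat_rep.
- by move=> y; exact: heat_rep_ge0.
by rewrite heat_repD// subrK fineK// muleC.
Qed.
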